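(* Let $n\ge 2$ be an integer. The representation of the Baumslag-Solitar group $\mathrm{BS}(1,n^2)=\langle b,t;\ tbt^{-1}=b^{n^2}\rangle$ into $\mathrm{SL}(2,\mathbb{Z}[\frac1n])$ defined by $$b\mapsto\begin{pmatrix}1&1\\0&1\end{pmatrix},\qquad t\mapsto\begin{pmatrix}n&0\\0&\frac1n\end{pmatrix}$$ is faithful.
   Context: The assignment respects the defining relation, so it defines a group homomorphism $\mathrm{BS}(1,n^2)\to\mathrm{SL}(2,\mathbb{Z}[\frac1n])$. *)

(* Defs.v *)
From HB Require Import structures.
From mathcomp Require Import all_boot all_order all_algebra.
From mathcomp Require Import generic_quotient boolp.

Set Implicit Arguments.
Unset Strict Implicit.
Unset Printing Implicit Defensive.

Import Order.TTheory GRing.Theory Num.Theory.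

(* The letter (x, false) stands for the generator x, (x, true) for x^-1. *)
Notation letter X := (X * bool)%type.
Notation word X := (seq (letter X)).

Section Presentation.
Local Open Scope group_scope.
Local Open Scope quotient_scope.
Variable X : choiceType.

Implicit Types (l : letter X) (u v w : word X).

Definition letter_inv l : letter X := (l.1, ~~ l.2).
Definition word_inv w : word X := rev (map letter_inv w).

Variable R : word X -> word X -> Prop.

(* The least congruence on words that contains the relations R and cancels a
   letter against its inverse. *)
Inductive word_eq : word X -> word X -> Prop :=
| word_eq_refl u : word_eq u u
| word_eq_sym u v : word_eq u v -> word_eq v u
| word_eq_trans u v w : word_eq u v -> word_eq v w -> word_eq u w
| word_eq_cat u u' v v' : word_eq u u' -> word_eq v v' ->
    word_eq (u ++ v) (u' ++ v')
| word_eq_cancel l : word_eq [:: l; letter_inv l] [::]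
| word_eq_rel u v : R u v -> word_eq u v.

Definition word_eqb u v : bool := `[< word_eq u v >].

Lemma word_eqb_equiv : equiv_class_of word_eqb.
Proof.
split=> [u|u v|v u w].
- exact/asboolP/word_eq_refl.
- by apply/asboolP/asboolP; apply: word_eq_sym.
- move=> /asboolP uv /asboolP vw.
  by apply/asboolP; apply: word_eq_trans uv vw.
Qed.

Canonical word_eqb_equiv_rel := EquivRelPack word_eqb_equiv.

Definition presented : Type := {eq_quot word_eqb_equiv_rel}.

HB.instance Definition _ := Choice.on presented.

Definition pres_word w : presented := \pi_presented w.
Definition pres_gen (x : X) : presented := pres_word [:: (x, false)].

Lemma pres_wordP u v : pres_word u = pres_word v <-> word_eq u v.
Proof.
split; first by move/eqmodP/asboolP.
by move=> uv; apply/eqmodP/asboolP.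
Qed.

Lemma pres_wordK (p : presented) : pres_word (repr p) = p.
Proof. exact: reprK. Qed.

Lemma word_eq_repr w : word_eq (repr (pres_word w)) w.
Proof. by apply/pres_wordP; rewrite pres_wordK. Qed.

Lemma letter_invK : involutive letter_inv.
Proof. by case=> x e; rewrite /letter_inv /= negbK. Qed.

Lemma word_invK : involutive word_inv.
Proof.
move=> w; rewrite /word_inv map_rev revK -map_comp -[RHS]map_id.
by apply: eq_map => l; apply: letter_invK.
Qed.

Lemma word_invP w : word_eq (w ++ word_inv w) [::].
Proof.
elim: w => [|l w IHw]; first exact: word_eq_refl.
rewrite /word_inv /= rev_cons -cats1 catA.
apply: word_eq_trans (word_eq_cancel l).
rewrite -[[:: l; _]]/([:: l] ++ [:: letter_inv l]).
rewrite -cat_cons; apply: word_eq_cat (word_eq_refl _).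
rewrite -[X in word_eq _ X]cats0 -cat1s; apply: word_eq_cat IHw.
exact: word_eq_refl.
Qed.

Lemma word_invVP w : word_eq (word_inv w ++ w) [::].
Proof. by have := word_invP (word_inv w); rewrite word_invK. Qed.

Lemma word_inv_eq u v : word_eq u v -> word_eq (word_inv u) (word_inv v).
Proof.
move=> uv; apply: (@word_eq_trans _ (word_inv u ++ (v ++ word_inv v))).
  rewrite -[X in word_eq X _]cats0.
  by apply: word_eq_cat (word_eq_refl _) _; apply/word_eq_sym/word_invP.
rewrite catA -[X in word_eq _ X]cat0s; apply: word_eq_cat (word_eq_refl _).
apply: (@word_eq_trans _ (word_inv u ++ u)).
  by apply: word_eq_cat (word_eq_refl _) _; apply: word_eq_sym.
exact: word_invVP.
Qed.

Definition pres_one : presented := pres_word [::].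
Definition pres_mul (p q : presented) : presented :=
  pres_word (repr p ++ repr q).
Definition pres_inv (p : presented) : presented := pres_word (word_inv (repr p)).

Lemma pres_mul_word u v : pres_mul (pres_word u) (pres_word v) = pres_word (u ++ v).
Proof. by apply/pres_wordP; apply: word_eq_cat; apply: word_eq_repr. Qed.

Lemma pres_inv_word u : pres_inv (pres_word u) = pres_word (word_inv u).
Proof. by apply/pres_wordP; apply/word_inv_eq/word_eq_repr. Qed.

Lemma pres_mulA : associative pres_mul.
Proof.
move=> p q r; rewrite -[p]pres_wordK -[q]pres_wordK -[r]pres_wordK.
by rewrite !pres_mul_word catA.
Qed.

Lemma pres_mul1g : left_id pres_one pres_mul.
Proof. by move=> p; rewrite -[p]pres_wordK pres_mul_word. Qed.

Lemma pres_mulg1 : right_id pres_one pres_mul.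
Proof. by move=> p; rewrite -[p]pres_wordK pres_mul_word cats0. Qed.

Lemma pres_mulgV : right_inverse pres_one pres_inv pres_mul.
Proof.
move=> p; rewrite -[p]pres_wordK pres_inv_word pres_mul_word.
exact/pres_wordP/word_invP.
Qed.

Lemma pres_mulVg : left_inverse pres_one pres_inv pres_mul.
Proof.
move=> p; rewrite -[p]pres_wordK pres_inv_word pres_mul_word.
exact/pres_wordP/word_invVP.
Qed.

HB.instance Definition _ := isGroup.Build presented
  pres_mulA pres_mul1g pres_mulg1 pres_mulVg pres_mulgV.

Section UniversalProperty.
Variables (G : groupType) (f : X -> G).

Definition letter_eval l : G := if l.2 then (f l.1)^-1 else f l.1.
Definition word_eval w : G := \prod_(l <- w) letter_eval l.

Definition respects : Prop := forall u v, R u v -> word_eval u = word_eval v.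

Hypothesis fR : respects.

Lemma word_eval_eq u v : word_eq u v -> word_eval u = word_eval v.
Proof.
elim=> {u v} // [u v w _ -> _ -> //|u u' v v' _ Hu _ Hv|[x e]].
- by rewrite /word_eval !big_cat; congr (_ * _).
- rewrite /word_eval !big_cons !big_nil mulg1 /letter_eval /=.
  by case: e => /=; rewrite ?mulVg ?mulgV.
Qed.

Definition pres_lift of respects := fun p : presented => word_eval (repr p).

Lemma pres_lift_word w : pres_lift fR (pres_word w) = word_eval w.
Proof. exact/word_eval_eq/word_eq_repr. Qed.

Lemma pres_lift_gen x : pres_lift fR (pres_gen x) = f x.
Proof. by rewrite pres_lift_word /word_eval big_seq1. Qed.

Lemma pres_lift_morph : monoid.monoid_morphism (pres_lift fR).
Proof.
split=> [|p q]; first by rewrite pres_lift_word /word_eval big_nil.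
by rewrite pres_lift_word /word_eval big_cat.
Qed.

HB.instance Definition _ := isUMagmaMorphism.Build presented G (pres_lift fR)
  pres_lift_morph.

End UniversalProperty.

End Presentation.

Inductive bs_letter : Set := Lb | Lt.

Definition bool_of_bs (l : bs_letter) : bool := if l is Lt then true else false.
Definition bs_of_bool (e : bool) : bs_letter := if e then Lt else Lb.
Lemma bool_of_bsK : cancel bool_of_bs bs_of_bool. Proof. by case. Qed.

HB.instance Definition _ := Choice.copy bs_letter (can_type bool_of_bsK).

Section BaumslagSolitar.
Local Open Scope group_scope.
Variables p q : nat.

Definition bs_rel (u v : word bs_letter) : Prop :=
  u = (Lt, false) :: nseq p (Lb, false) ++ [:: (Lt, true)]
  /\ v = nseq q (Lb, false).

Definition BS : Type := presented bs_rel.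

HB.instance Definition _ := monoid.Group.on BS.

Definition bs_b : BS := pres_gen bs_rel Lb.
Definition bs_t : BS := pres_gen bs_rel Lt.

Lemma bs_bX k : bs_b ^+ k = pres_word bs_rel (nseq k (Lb, false)).
Proof. by elim: k => // k IHk; rewrite expgS IHk; apply: pres_mul_word. Qed.

Lemma bs_relation : bs_t * bs_b ^+ p * bs_t^-1 = bs_b ^+ q.
Proof.
rewrite !bs_bX [bs_t^-1]pres_inv_word.
rewrite [bs_t * _]pres_mul_word [LHS]pres_mul_word.
exact/pres_wordP/word_eq_rel.
Qed.

End BaumslagSolitar.

Section SpecialLinear.
Local Open Scope ring_scope.
Variables (m : nat) (R : comNzRingType).

Record SL : Type := MkSL { SLval :> 'M[R]_m; _ : \det SLval == 1 }.

HB.instance Definition _ := [isSub for SLval].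
HB.instance Definition _ := [Choice of SL by <:].

Lemma SL_det (A : SL) : \det A = 1.
Proof. exact/eqP/(valP A). Qed.

Lemma SL_one_subproof : \det (1%:M : 'M[R]_m) == 1.
Proof. by rewrite det1. Qed.

Lemma SL_mul_subproof (A B : SL) : \det (A *m B) == 1.
Proof. by rewrite det_mulmx !SL_det mulr1. Qed.

Lemma SL_inv_subproof (A : SL) : \det (\adj A) == 1.
Proof.
have := congr1 determinant (mul_mx_adj A).
by rewrite det_mulmx !SL_det det1 mul1r => ->.
Qed.

Definition SL_one : SL := MkSL SL_one_subproof.
Definition SL_mul (A B : SL) : SL := MkSL (SL_mul_subproof A B).
Definition SL_inv (A : SL) : SL := MkSL (SL_inv_subproof A).

Lemma SL_mulA : associative SL_mul.
Proof. by move=> A B C; apply/val_inj/mulmxA. Qed.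
Lemma SL_mul1g : left_id SL_one SL_mul.
Proof. by move=> A; apply/val_inj/mul1mx. Qed.
Lemma SL_mulg1 : right_id SL_one SL_mul.
Proof. by move=> A; apply/val_inj/mulmx1. Qed.
Lemma SL_mulVg : left_inverse SL_one SL_inv SL_mul.
Proof. by move=> A; apply/val_inj; rewrite /= mul_adj_mx SL_det. Qed.
Lemma SL_mulgV : right_inverse SL_one SL_inv SL_mul.
Proof. by move=> A; apply/val_inj; rewrite /= mul_mx_adj SL_det. Qed.

HB.instance Definition _ := isGroup.Build SL
  SL_mulA SL_mul1g SL_mulg1 SL_mulVg SL_mulgV.

End SpecialLinear.

Section ZInv.
Local Open Scope ring_scope.
Variable n : nat.

Definition Zinv_pred : {pred rat} :=
  fun x => `[< exists (a : int) (k : nat), x = a%:~R / n%:R ^+ k >].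

Lemma Zinv_predP x :
  reflect (exists (a : int) (k : nat), x = a%:~R / n%:R ^+ k) (x \in Zinv_pred).
Proof. exact: asboolP. Qed.

Lemma Zinv_subring_closed : subring_closed Zinv_pred.
Proof.
split.
- by apply/Zinv_predP; exists 1, 0%N; rewrite expr0 divr1.
- move=> _ _ /Zinv_predP[a [k ->]] /Zinv_predP[b [l ->]]; apply/Zinv_predP.
  have [n0|n_neq0] := eqVneq (n%:R : rat) 0.
    exists (a * (k == 0%N)%:R - b * (l == 0%N)%:R), 0%N.
    rewrite n0 expr0 divr1 !expr0n rmorphB !rmorphM /= !rmorph_nat.
    by case: (k == _); case: (l == _); rewrite ?invr1 ?invr0.
  exists (a * n%:R ^+ l - b * n%:R ^+ k), (k + l)%N.
  rewrite rmorphB !rmorphM !rmorphXn /= !rmorph_nat exprD.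
  by rewrite -!mulNr addf_div ?expf_neq0.
- move=> _ _ /Zinv_predP[a [k ->]] /Zinv_predP[b [l ->]]; apply/Zinv_predP.
  by exists (a * b), (k + l)%N; rewrite rmorphM exprD invfM mulrACA.
Qed.

HB.instance Definition _ := GRing.isSubringClosed.Build rat Zinv_pred
  Zinv_subring_closed.

Record Zinv : Type := MkZinv { Zinv_val :> rat; _ : Zinv_val \in Zinv_pred }.

HB.instance Definition _ := [isSub for Zinv_val].
HB.instance Definition _ := [Choice of Zinv by <:].
HB.instance Definition _ := [SubChoice_isSubComNzRing of Zinv by <:].

Lemma Zinv_inv_subproof : (n%:R)^-1 \in Zinv_pred.
Proof. by apply/Zinv_predP; exists 1, 1%N; rewrite mul1r expr1. Qed.

Definition Zinv_inv : Zinv := MkZinv Zinv_inv_subproof.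

Lemma Zinv_natV : (0 < n)%N -> n%:R * Zinv_inv = 1 :> Zinv.
Proof.
move=> n_gt0; apply: val_inj; rewrite rmorphM rmorph_nat rmorph1 /= divff //.
by rewrite pnatr_eq0 -lt0n.
Qed.

End ZInv.

Local Open Scope ring_scope.

Definition mx2 (R : pzRingType) (a b c d : R) : 'M[R]_2 :=
  \matrix_(i, j) if i == 0 then if j == 0 then a else b
                  else if j == 0 then c else d.

Lemma det_mx2 (R : comNzRingType) (a b c d : R) :
  \det (mx2 a b c d) = a * d - b * c.
Proof.
rewrite (expand_det_row _ 0) !big_ord_recl big_ord0 addr0 /cofactor !det_mx11.
by rewrite !mxE /= expr0 expr1 mul1r mulN1r mulrN.
Qed.

Lemma mul_mx2 (R : pzRingType) (a b c d a' b' c' d' : R) :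
  mx2 a b c d *m mx2 a' b' c' d' =
   mx2 (a * a' + b * c') (a * b' + b * d') (c * a' + d * c') (c * b' + d * d').
Proof.
apply/matrixP=> i j; rewrite !mxE !big_ord_recl big_ord0 addr0 !mxE /=.
by case: (i == 0); case: (j == 0).
Qed.

Section Representation.
Variable n : nat.
Hypothesis n_ge2 : (2 <= n)%N.

Local Notation R := (Zinv n).

Lemma mx_b_subproof : \det (mx2 1 1 0 1 : 'M[R]_2) == 1.
Proof. by rewrite det_mx2 mulr1 mulr0 subr0. Qed.

Lemma mx_t_subproof : \det (mx2 n%:R 0 0 (Zinv_inv n)) == 1.
Proof. by rewrite det_mx2 mulr0 subr0 Zinv_natV // ltnW. Qed.

Definition bs_gen_mx (x : bs_letter) : SL 2 R :=
  match x with
  | Lb => MkSL mx_b_subproof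
  | Lt => MkSL mx_t_subproof
  end.

Lemma bs_gen_mx_bX k :
  (bs_gen_mx Lb ^+ k)%g = mx2 1 k%:R 0 1 :> 'M[R]_2.
Proof.
elim: k => [|k IHk]; first by apply/matrixP; do 2?[case=> [[|[|//]] ?]]; rewrite !mxE.
rewrite expgS /= IHk mul_mx2 !(mul1r, mulr0, mul0r, mulr1, addr0, add0r).
by rewrite -natr1.
Qed.

Lemma bs_gen_mx_respects : respects (bs_rel 1 (n ^ 2)%N) bs_gen_mx.
Proof.
move=> _ _ [-> ->]; rewrite /word_eval !big_cons big_nil /letter_eval /=.
have -> : (\prod_(l <- nseq (n ^ 2)%N (Lb, false)) letter_eval bs_gen_mx l
           = bs_gen_mx Lb ^+ (n ^ 2)%N)%g.
  by elim: (n ^ 2)%N => [|k IHk]; rewrite ?big_nil // big_cons IHk expgS.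
rewrite mulg1 mulgA; apply: (mulIg (bs_gen_mx Lt)); rewrite mulgVK.
apply: val_inj; rewrite /= bs_gen_mx_bX !mul_mx2.
rewrite !(mul1r, mulr0, mul0r, mulr1, addr0, add0r).
by rewrite natrX expr2 -mulrA Zinv_natV ?mulr1 // ltnW.
Qed.

Definition bs_rep : {multiplicative BS 1 (n ^ 2) -> SL 2 R} :=
  pres_lift bs_gen_mx_respects.

Lemma bs_rep_b : bs_rep (bs_b 1 (n ^ 2)) = mx2 1 1 0 1 :> 'M[R]_2.
Proof.
by rewrite -[RHS]/(SLval (bs_gen_mx Lb)) -(pres_lift_gen bs_gen_mx_respects).
Qed.

Lemma bs_rep_t : bs_rep (bs_t 1 (n ^ 2)) = mx2 n%:R 0 0 (Zinv_inv n) :> 'M[R]_2.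
Proof.
by rewrite -[RHS]/(SLval (bs_gen_mx Lt)) -(pres_lift_gen bs_gen_mx_respects).
Qed.

End Representation.

(* Main.v *)
Require Import Defs.
From mathcomp Require Import all_boot all_order all_algebra.

(** The relation [t b = b^q t] makes the monoid of the elements [b^x t^j] a left Ore
    set: [b u^-1 = u^-1 b^(q^i)] for [u = b^y t^i], and
    [t u^-1 = w^-1 t] for [w = b^(q y) t^i].  Hence every element of [BS(1,q)] is
    a left fraction [(b^y t^i)^-1 (b^x t^j)].  For [q = n^2], the image of
    [b^x t^j] has diagonal [n^j, n^-j] and corner [x n^-j], which determines
    [x] and [j]; so a fraction in the kernel has equal terms. *)

Import GRing.Theory Num.Theory.

Section OreFractions.
Local Open Scope group_scope.
Variable q : nat.
Local Notation b := (bs_b 1 q).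
Local Notation t := (bs_t 1 q).

Definition bs_mon (x j : nat) : BS 1 q := b ^+ x * t ^+ j.

Lemma mul_bs_tb : t * b = b ^+ q * t.
Proof. by rewrite -(bs_relation 1 q) mulgVK. Qed.

Lemma mul_bs_t_bX x : t * b ^+ x = b ^+ (q * x) * t.
Proof.
elim: x => [|x IHx]; first by rewrite muln0 mulg1 mul1g.
by rewrite expgS mulgA mul_bs_tb -mulgA IHx mulgA -expgnDr -mulnS.
Qed.

Lemma mul_bs_tX_b j : t ^+ j * b = b ^+ (q ^ j) * t ^+ j.
Proof.
elim: j => [|j IHj]; first by rewrite mul1g mulg1 expn0 expg1.
by rewrite expgS -mulgA IHj mulgA mul_bs_t_bX -mulgA -expnS.
Qed.

(** In [bs_fraction], left products by generators extend numerators and right products extend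
    denominators. *)
Lemma bs_bX_mon k x j : b ^+ k * bs_mon x j = bs_mon (k + x) j.
Proof. by rewrite /bs_mon mulgA expgnDr. Qed.

Lemma bs_t_mon x j : t * bs_mon x j = bs_mon (q * x) j.+1.
Proof. by rewrite /bs_mon mulgA mul_bs_t_bX -mulgA -expgS. Qed.

Lemma bs_mon_b x j : bs_mon x j * b = bs_mon (q ^ j + x) j.
Proof. by rewrite /bs_mon -mulgA mul_bs_tX_b mulgA -expgnDr addnC. Qed.

Lemma bs_mon_t x j : bs_mon x j * t = bs_mon x j.+1.
Proof. by rewrite /bs_mon -mulgA -expgSr. Qed.

(** Induction on a word for [g], prepending one letter: an inverse letter is absorbed by the
    denominator, while a positive letter crosses it and joins the numerator. *)
Lemma bs_fraction (g : BS 1 q) :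
  exists y i x j, g = (bs_mon y i)^-1 * bs_mon x j.
Proof.
rewrite -[g]pres_wordK; elim: (repr g) => [|l w [y [i [x [j IHw]]]]].
  by exists 0, 0, 0, 0; rewrite mulVg.
rewrite -cat1s -pres_mul_word IHw.
have mulgE (h k : BS 1 q) : pres_mul h k = h * k by [].
rewrite mulgE {w IHw}.
case: l => -[] [].
- have -> : pres_word (bs_rel 1 q) [:: (Lb, true)] = b^-1.
    by rewrite /bs_b [RHS]pres_inv_word.
  by rewrite mulgA -invgM bs_mon_b; do 4!eexists.
- rewrite -/(pres_gen _ Lb) -/b mulgA.
  have -> : b * (bs_mon y i)^-1 = (bs_mon y i)^-1 * b ^+ (q ^ i).
    (* Powers of [b] commute, so conjugation by [b ^+ y * t ^+ i] acts on [b] as [t ^+ i] does. *)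
    apply: (mulgI (bs_mon y i)); rewrite mulVKg mulgA bs_mon_b -bs_bX_mon.
    by rewrite mulgK.
  by rewrite -mulgA bs_bX_mon; do 4!eexists.
- have -> : pres_word (bs_rel 1 q) [:: (Lt, true)] = t^-1.
    by rewrite /bs_t [RHS]pres_inv_word.
  by rewrite mulgA -invgM bs_mon_t; do 4!eexists.
- rewrite -/(pres_gen _ Lt) -/t mulgA.
  have -> : t * (bs_mon y i)^-1 = (bs_mon (q * y) i)^-1 * t.
    (* Both [bs_mon (q * y) i * t] and [t * bs_mon y i] equal [bs_mon (q * y) i.+1]. *)
    apply: (mulgI (bs_mon (q * y) i)).
    by rewrite mulVKg mulgA bs_mon_t -bs_t_mon mulgK.
  by rewrite -mulgA bs_t_mon; do 4!eexists.
Qed.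

End OreFractions.

Section Faithful.
Local Open Scope ring_scope.
Variables (n : nat) (n_ge2 : (2 <= n)%N).

Lemma Zinv_natr_inj : injective (fun k : nat => k%:R : Zinv n).
Proof.
move=> k l /(congr1 val); rewrite !rmorph_nat.
by move/eqP; rewrite eqr_nat => /eqP.
Qed.

Lemma mx2_inj (R : pzRingType) (a b c d a' b' c' d' : R) :
  mx2 a b c d = mx2 a' b' c' d' -> [/\ a = a', b = b', c = c' & d = d'].
Proof.
move=> /matrixP e.
by split; [move: (e 0 0) | move: (e 0 1) | move: (e 1 0) | move: (e 1 1)];
  rewrite !mxE.
Qed.

Lemma bs_gen_mx_tX j :
  (bs_gen_mx n_ge2 Lt ^+ j)%g
    = mx2 (n%:R ^+ j) 0 0 (Zinv_inv n ^+ j) :> 'M[Zinv n]_2.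
Proof.
elim: j => [|j IHj].
  by apply/matrixP; do 2?[case=> [[|[|//]] ?]]; rewrite !mxE.
by rewrite expgS /= IHj mul_mx2 !(mulr0, mul0r, addr0, add0r) -!exprS.
Qed.

Lemma bs_rep_mon x j :
  bs_rep n_ge2 (bs_mon (n ^ 2) x j)
    = mx2 (n%:R ^+ j) (x%:R * Zinv_inv n ^+ j) 0 (Zinv_inv n ^+ j)
    :> 'M[Zinv n]_2.
Proof.
rewrite gmulfM !gmulfXn [bs_rep _ (bs_b _ _)]pres_lift_gen.
rewrite [bs_rep _ (bs_t _ _)]pres_lift_gen.
rewrite -[LHS]/(SLval (bs_gen_mx n_ge2 Lb ^+ x)%g
                 *m SLval (bs_gen_mx n_ge2 Lt ^+ j)%g).
rewrite bs_gen_mx_bX bs_gen_mx_tX mul_mx2.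
by rewrite !(mul1r, mulr0, mul0r, addr0, add0r).
Qed.

Lemma bs_rep_mon_inj x j y i :
  bs_rep n_ge2 (bs_mon (n ^ 2) x j) = bs_rep n_ge2 (bs_mon (n ^ 2) y i) ->
  x = y /\ j = i.
Proof.
move/(congr1 (@SLval _ _)); rewrite !bs_rep_mon => /mx2_inj[e_ul e_ur _ _].
have ji : j = i.
  move: e_ul; rewrite -!natrX => /Zinv_natr_inj /eqP.
  by rewrite eqn_exp2l // => /eqP.
(* Multiplying the corner entries by [n%:R ^+ i] clears the denominators and leaves [x] and [y]. *)
split=> //; move: e_ur; rewrite ji => /(congr1 ( *%R^~ (n%:R ^+ i))).
rewrite -!mulrA -!exprMn ![Zinv_inv n * _]mulrC Zinv_natV ?expr1n ?mulr1.
  exact: Zinv_natr_inj.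
exact: ltnW.
Qed.

End Faithful.

Theorem theorem5p4 (n : nat) (n_ge2 : (2 <= n)%N) : injective (bs_rep n_ge2).
Proof.
apply: gmulf_inj => g; have [y [i [x [j ->]]]] := bs_fraction _ g.
(* A fraction has trivial image exactly when its two terms have the same image. *)
rewrite gmulfM gmulfV => /mulg1_eq; rewrite invgK => /bs_rep_mon_inj[-> ->].
exact: mulVg.
Qed.
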